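(* Let $R$ be a commutative principal ideal domain and let $Q$ be the field of fractions of $R$, regarded as an $R$-module. (a) If $R$ is local, then $Q$ is a uniserial (hence weakly uniserial) $R$-module. (b) If $R$ is not local, then $Q$ is not a weakly uniserial $R$-module.
   Context: A module is uniserial if its submodules are linearly ordered by inclusion. A module $M$ is called weakly uniserial if for any two submodules $N$ and $K$ of $M$ there exists an injective module homomorphism $N\to K$ or an injective module homomorphism $K\to N$. A ring is local if it has a unique maximal ideal. *)

(* Defs.v *)
From HB Require Import structures.
From mathcomp Require Import all_boot all_order all_algebra.
From mathcomp Require Import fraction.
From mathcomp Require Import boolp classical_sets.

Set Implicit Arguments.
Unset Strict Implicit.
Unset Printing Implicit Defensive.

Import GRing.Theory.
Local Open Scope classical_set_scope.
Local Open Scope ring_scope.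

(* Submodules are arbitrary (not necessarily decidable) subsets: membership in
   a [set V] is made boolean by classical choice, so that [submod_closed] and
   the sub-lmodule structures of MathComp apply to it. *)
Record submodule (R : nzRingType) (V : lmodType R) := Submodule {
  submodule_set :> set V;
  submodule_closed : GRing.submod_closed [in submodule_set]
}.

Definition submodule_pred (R : nzRingType) (V : lmodType R)
  (N : submodule V) : {pred V} := [in submodule_set N].

HB.instance Definition _ (R : nzRingType) (V : lmodType R) (N : submodule V) :=
  GRing.isSubmodClosed.Build R V (submodule_pred N) (submodule_closed N).

Definition submodule_type (R : nzRingType) (V : lmodType R)
  (N : submodule V) : Type := {x : V | x \in submodule_pred N}.

HB.instance Definition _ (R : nzRingType) (V : lmodType R) (N : submodule V) :=
  SubChoice.on (submodule_type N).
HB.instance Definition _ (R : nzRingType) (V : lmodType R) (N : submodule V) :=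
  [SubChoice_isSubLmodule of submodule_type N by <:].

Definition uniserial (R : nzRingType) (V : lmodType R) : Prop :=
  forall N K : submodule V, N `<=` K \/ K `<=` N.

Definition embeds (R : nzRingType) (U V : lmodType R) : Prop :=
  exists f : {linear U -> V}, injective f.

Definition weakly_uniserial (R : nzRingType) (V : lmodType R) : Prop :=
  forall N K : submodule V,
    embeds (submodule_type N) (submodule_type K) \/
    embeds (submodule_type K) (submodule_type N).

(* MathComp's [idealr] only covers proper ideals, so ideals of a commutative
   ring are taken to be the submodules of the regular module. *)
Definition ideal (R : comNzRingType) : Type := submodule R^o.

Definition maximal_ideal (R : comNzRingType) (M : ideal R) : Prop :=
  M <> setT :> set R /\
  forall J : ideal R, M `<=` J -> J <> setT :> set R -> J = M :> set R.

Definition local_ring (R : comNzRingType) : Prop :=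
  exists M : ideal R, maximal_ideal M /\
    forall M' : ideal R, maximal_ideal M' -> M' = M :> set R.

Definition principal_ideal_domain (R : idomainType) : Prop :=
  forall I : ideal R, exists a : R, I = [set r * a | r in [set: R]] :> set R.

(* An alias, so that {fraction R} itself is not globally an lmodType over R. *)
Definition fraction_module (R : idomainType) : Type := {fraction R}.

Section FractionModule.
Variable R : idomainType.
Local Notation tofrac := (@FracField.tofrac R).

HB.instance Definition _ := GRing.Zmodule.on (fraction_module R).

Definition fraction_scale (r : R) (x : fraction_module R) : fraction_module R :=
  tofrac r * (x : {fraction R}).

Fact fraction_scaleA r s x :
  fraction_scale r (fraction_scale s x) = fraction_scale (r * s) x.
Proof. by rewrite /fraction_scale rmorphM mulrA. Qed.

Fact fraction_scale1 : left_id 1 fraction_scale.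
Proof. by move=> x; rewrite /fraction_scale rmorph1 mul1r. Qed.

Fact fraction_scaleDr : right_distributive fraction_scale +%R.
Proof. by move=> r x y; rewrite /fraction_scale mulrDr. Qed.

Fact fraction_scaleDl x : {morph fraction_scale^~ x : r s / r + s}.
Proof. by move=> r s; rewrite /fraction_scale rmorphD mulrDl. Qed.

HB.instance Definition _ :=
  GRing.Zmodule_isLmodule.Build R (fraction_module R)
    fraction_scaleA fraction_scale1 fraction_scaleDr fraction_scaleDl.

End FractionModule.

(* Main.v *)
From HB Require Import structures.
Require Import Defs.
From mathcomp Require Import all_boot all_order all_algebra.
From mathcomp Require Import fraction generic_quotient ring.
From mathcomp Require Import boolp classical_sets.

(** For a, b in a principal ideal domain, write a = a' d, b = b' d with
    x a' + y b' = 1.  If R is local then a' or b' is a unit, so divisibility is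
    total on R, hence any two fractions are R-multiples of one another one way or
    the other, and Q is uniserial.  If R is not local, there are non-units a, b
    with x a + y b = 1.  An embedding f of R[1/a] into R[1/b] would give a
    nonzero f(1) divisible by every power of a in R[1/b]; clearing denominators
    and using comaximality, a nonzero element of R divisible by every power of
    the non-unit a, which a principal ideal domain does not allow. *)

Set Implicit Arguments.
Unset Strict Implicit.
Unset Printing Implicit Defensive.

Import GRing.Theory.
Local Open Scope classical_set_scope.
Local Open Scope quotient_scope.
Local Open Scope ring_scope.

Local Notation "x %:F" := (@FracField.tofrac _ x).

(** * Submodules and the embeddings given by inclusions *)

Section Submodules.
Variables (R : nzRingType) (V : lmodType R).

Lemma in_submod_closed (A : set V) :
  A 0 -> (forall r u v, A u -> A v -> A (r *: u + v)) ->
  GRing.submod_closed [in A].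
Proof.
move=> A0 Alin; split; first exact/mem_set.
by move=> r u v /set_mem Au /set_mem Av; apply/mem_set/Alin.
Qed.

Lemma submodule0 (N : submodule V) : submodule_set N 0.
Proof. exact/set_mem/(submodule_closed N).1. Qed.

Lemma submoduleP (N : submodule V) r u v :
  submodule_set N u -> submodule_set N v -> submodule_set N (r *: u + v).
Proof.
by move=> Nu Nv; apply/set_mem/(submodule_closed N).2; apply/mem_set.
Qed.

Lemma submoduleZ (N : submodule V) r u :
  submodule_set N u -> submodule_set N (r *: u).
Proof.
by move=> Nu; rewrite -[_ *: _]addr0; apply: submoduleP => //; exact: submodule0.
Qed.

Section Inclusion.
Variables (N K : submodule V) (NK : N `<=` K).

Fact submodule_incl_subproof (x : submodule_type N) :
  \val x \in submodule_pred K.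
Proof. exact/mem_set/NK/set_mem/(valP x). Qed.

Definition submodule_incl (x : submodule_type N) : submodule_type K :=
  Sub (\val x) (submodule_incl_subproof x).

Fact submodule_incl_is_linear : linear submodule_incl.
Proof. by move=> r u v; apply: val_inj. Qed.

HB.instance Definition _ :=
  GRing.isLinear.Build R (submodule_type N) (submodule_type K) _
    submodule_incl submodule_incl_is_linear.

Lemma embeds_sub : embeds (submodule_type N) (submodule_type K).
Proof.
by exists submodule_incl => u v /(congr1 \val) uv; apply: val_inj.
Qed.

End Inclusion.

Lemma uniserial_weakly : uniserial V -> weakly_uniserial V.
Proof. by move=> uV N K; case: (uV N K) => /embeds_sub; [left | right]. Qed.

End Submodules.

(** * Maximal ideals and an elementwise criterion for locality *)

Section LocalRings.
Variable R : comUnitRingType.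
Implicit Types (I : ideal R) (a b : R).

Lemma unit_ideal I a : a \is a GRing.unit -> submodule_set I a -> I = setT :> set R.
Proof.
move=> ua Ia; apply/seteqP; split=> // r _.
by have := submoduleZ (r / a) Ia; rewrite /GRing.scale /= mulrVK.
Qed.

Lemma nonunit_in_maximal a :
  a \isn't a GRing.unit -> exists M : ideal R, maximal_ideal M /\ submodule_set M a.
Proof.
move=> nua.
(* The empty set is allowed, since it is the union of the empty chain. *)
pose P (A : set R) := [/\ forall r u v, A u -> A v -> A (r * u + v), ~ A 1
                       & A !=set0 -> A a].
have [|A [[Alin A1 Aa] Amax]] := @Zorn_bigcup R P.
  move=> F FP Ftot; split.
  - move=> r u v [B FB Bu] [C FC Cv]; have [BC|CB] := Ftot _ _ FB FC.
    + by exists C => //; have [Clin _ _] := FP _ FC; apply: Clin => //; apply: BC.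
    + by exists B => //; have [Blin _ _] := FP _ FB; apply: Blin => //; apply: CB.
  - by case=> B FB B1; have [_ + _] := FP _ FB.
  - case=> u [B FB Bu]; exists B => //; have [_ _ +] := FP _ FB.
    by apply; exists u.
(* If [A] missed [a] it would be empty, and the ideal generated by [a], proper since [a] is not a
   unit, would strictly contain it. *)
have {}Aa : A a.
  apply: contrapT => nAa; apply: (Amax [set r * a | r in setT]).
    split; last by move=> sub; apply/nAa/sub; exists 1; rewrite ?mul1r.
    by move=> u Au; case: nAa; apply: Aa; exists u.
  split.
  - by move=> r _ _ [s _ <-] [t _ <-]; exists (r * s + t) => //; rewrite mulrDl mulrA.
  - by case=> r _ ra; move/negP: nua; apply; apply/unitrPr; exists r; rewrite mulrC.
  - by move=> _; exists 1; rewrite ?mul1r.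
have A0 : A 0 by have := Alin (-1) a a Aa Aa; rewrite mulN1r addNr.
exists (@Submodule R R^o A (@in_submod_closed R R^o A A0 Alin)); split=> //.
split=> /= [AT|J AJ JT]; first by apply: A1; rewrite AT.
apply: contrapT => JA; apply: (Amax J).
  by split=> // JA'; apply: JA; apply/seteqP.
split; [exact: (@submoduleP R R^o J) | | by move=> _; apply: AJ].
by move=> J1; apply: JT; apply: unit_ideal J1; apply: unitr1.
Qed.

(** Two non-units lie in maximal ideals; if these coincide, no combination of the two is 1.
    Conversely, the criterion makes the non-units an ideal, which contains every proper ideal. *)
Lemma local_ringP : local_ring R <->
  forall a b x y, x * a + y * b = 1 ->
    a \is a GRing.unit \/ b \is a GRing.unit.
Proof.
split=> [[M [[MT _] Muniq]] a b x y xayb1|comaxR].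
  apply: contrapT => /not_orP[/negP/nonunit_in_maximal[A [mA Aa]]].
  move=> /negP/nonunit_in_maximal[B [mB Bb]].
  apply: MT; apply: (@unit_ideal _ 1); first exact: unitr1.
  rewrite -xayb1; apply: submoduleP; first by rewrite -(Muniq A).
  by apply: submoduleZ; rewrite -(Muniq B).
pose N : set R := [set r | r \isn't a GRing.unit].
have N0 : N 0 by rewrite /N /= unitr0.
have Nlin r u v : N u -> N v -> N (r * u + v).
  move=> Nu Nv; apply/negP => urv.
  have := comaxR u v ((r * u + v)^-1 * r) (r * u + v)^-1.
  rewrite -mulrA -mulrDr mulVr // => /(_ erefl)[uu|uv].
    by move: Nu; rewrite /N /= uu.
  by move: Nv; rewrite /N /= uv.
pose NI : ideal R := @Submodule R R^o N (@in_submod_closed R R^o N N0 Nlin).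
have subN (J : ideal R) : J <> setT :> set R -> J `<=` N.
  by move=> JT r Jr; apply/negP => ur; apply: JT; apply: unit_ideal Jr.
have mN : maximal_ideal NI.
  split=> /= [NT|J NJ JT].
    suff: N 1 by rewrite /N /= unitr1.
    by rewrite NT.
  by apply/seteqP; split=> //; apply: subN.
exists NI; split=> // J [JT Jmax]; apply/esym/Jmax; first exact: subN.
by case: mN.
Qed.

End LocalRings.

(** * Comaximal elements: powers and cancellation *)

Section Comaximal.
Variable R : comNzRingType.
Implicit Types a b c d : R.

Lemma comaximalX a b : (exists x y, x * a + y * b = 1) ->
  forall n, exists x y, x * a ^+ n + y * b = 1.
Proof.
move=> [x [y xy1]]; elim=> [|n [u [v uv1]]].
  by exists 1, 0; rewrite mulr1 mul0r addr0.
(* Expand [(u * a ^+ n + v * b) * (x * a + y * b)]: every term but the first is a multiple of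
   [b]. *)
exists (u * x), (u * a ^+ n * y + v * x * a + v * y * b).
by rewrite -[1]mulr1 -{1}uv1 -xy1 exprS; ring.
Qed.

(** One factor [b] is cancelled at a time: multiplying [c * b ^+ m] by [x * d + y * b] gives a
    multiple of [d] plus [y * (c * b ^+ m.+1)]. *)
Lemma comaximal_dvd d b : (exists x y, x * d + y * b = 1) ->
  forall m c, (exists t, c * b ^+ m = t * d) -> exists t, c = t * d.
Proof.
move=> [x [y xy1]]; elim=> [|m IH] c [t ct]; first by exists t; rewrite -ct mulr1.
apply: IH; exists (c * b ^+ m * x + y * t).
rewrite -[LHS]mulr1 -xy1.
transitivity (c * b ^+ m * x * d + y * (c * b ^+ m.+1)); first by rewrite exprS; ring.
by rewrite ct; ring.
Qed.

End Comaximal.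

(** * Bezout relations and divisibility by all powers *)

Section PrincipalIdealDomains.
Variable R : idomainType.
Hypothesis pidR : principal_ideal_domain R.
Implicit Types a b c : R.

Lemma pid_comaximal a b : exists d a' b' x y,
  [/\ a = a' * d, b = b' * d & x * a' + y * b' = 1].
Proof.
pose A : set R := [set r | exists x y, r = x * a + y * b].
have A0 : A 0 by exists 0, 0; rewrite !mul0r addr0.
have Alin r u v : A u -> A v -> A (r * u + v).
  move=> [x [y ->]] [s [t ->]]; exists (r * x + s), (r * y + t); ring.
have [d /= Ad] := pidR (@Submodule R R^o A (@in_submod_closed R R^o A A0 Alin)).
have : A a by exists 1, 0; rewrite mul1r mul0r addr0.
rewrite Ad => -[a' _ aE].
have : A b by exists 0, 1; rewrite mul1r mul0r add0r.
rewrite Ad => -[b' _ bE].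
have : A d by rewrite Ad; exists 1; rewrite ?mul1r.
move=> [x [y dE]].
have [d0|d0] := eqVneq d 0.
  (* Here [a = b = 0] and [d] cannot be cancelled, but any comaximal cofactors will do. *)
  exists 0, 1, 1, 1, 0; rewrite -aE -bE d0; split; rewrite ?mulr0 //.
  by rewrite mulr1 mul0r addr0.
exists d, a', b', x, y; split=> //; apply: (mulIf d0).
by rewrite mul1r mulrDl -!mulrA aE bE.
Qed.

(* The ideal of the g with c | a^n g for some n contains every quotient
   r_n = c / a^n; it is generated by some g with a^n g = c t.  As r_(n+1) is a
   multiple s g of g, this gives g = a s t g. *)
Lemma pid_dvdX_unit a c : c != 0 ->
  (forall n, exists r, c = r * a ^+ n) -> a \is a GRing.unit.
Proof.
move=> c0 ac.
have a0 : a != 0.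
  by have [r cE] := ac 1%N; apply: contraNneq c0 => a0; rewrite cE a0 mulr0.
pose A : set R := [set g | exists n t, a ^+ n * g = c * t].
have A0 : A 0 by exists 0%N, 0; rewrite !mulr0.
have Alin r u v : A u -> A v -> A (r * u + v).
  move=> [n [s nu]] [m [t mv]]; exists (n + m)%N, (r * a ^+ m * s + a ^+ n * t).
  transitivity (r * a ^+ m * (a ^+ n * u) + a ^+ n * (a ^+ m * v)).
    by rewrite exprD; ring.
  by rewrite nu mv; ring.
have [g /= Ag] := pidR (@Submodule R R^o A (@in_submod_closed R R^o A A0 Alin)).
have : A g by rewrite Ag; exists 1; rewrite ?mul1r.
move=> [n [t gt]].
have [r cE] := ac n.+1.
have : A r by exists n.+1, 1; rewrite mulr1 mulrC -cE.
rewrite Ag => -[s _ rE].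
have g0 : g != 0.
  by apply: contraNneq c0 => g0; rewrite cE -rE g0 mulr0 mul0r.
have ast : s * t * a = 1.
  apply: (mulIf g0); apply: (mulfI (expf_neq0 n a0)).
  by rewrite mul1r gt cE -rE exprS; ring.
by apply/unitrPr; exists (s * t); rewrite mulrC.
Qed.

End PrincipalIdealDomains.

(** * Submodules of the fraction field *)

Section FractionModule.
Variable R : idomainType.
Implicit Types a b : R.

Lemma frac_numden (x : {fraction R}) :
  exists p q : R, q != 0 /\ x = p%:F / q%:F.
Proof.
elim/quotW: x => x; exists \n_x, \d_x; split; first exact: denom_ratioP.
apply/(canRL (mulfK _)); first by rewrite tofrac_eq0 denom_ratioP.
unlock FracField.tofrac; rewrite -[LHS]FracField.pi_mul; apply/eqmodP.
rewrite /= FracField.equivfE /FracField.mulf.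
by rewrite !numden_Ratio ?mulf_neq0 ?oner_eq0 ?denom_ratioP // !mulr1 mulrC.
Qed.

Lemma uniserial_fraction :
  (forall a b, (exists t, b = t * a) \/ (exists t, a = t * b)) ->
  uniserial (fraction_module R).
Proof.
move=> dvdT N K; have [NK|] := pselect (N `<=` K); first by left.
move=> /existsNP[x /not_implyP[Nx nKx]]; right=> y Ky.
have [p [q [q0 xE]]] := frac_numden x.
have [r [s [s0 yE]]] := frac_numden y.
have qF : q%:F != 0 by rewrite tofrac_eq0.
have sF : s%:F != 0 by rewrite tofrac_eq0.
(* With [x] = p/q and [y] = r/s, cross-multiplication turns divisibility between [p * s] and [r * q]
   into [y = t *: x] or [x = t *: y]; the latter would put [x] in [K]. *)
have [[t tE]|[t tE]] := dvdT (p * s) (r * q).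
  suff -> : y = t *: x by apply: submoduleZ.
  rewrite xE yE /GRing.scale /= /fraction_scale mulrA -tofracM.
  by apply/eqP; rewrite eqr_div // -!tofracM tE -mulrA.
case: nKx; suff -> : x = t *: y by apply: submoduleZ.
rewrite xE yE /GRing.scale /= /fraction_scale mulrA -tofracM.
by apply/eqP; rewrite eqr_div // -!tofracM tE -mulrA.
Qed.

Fact fractions_over_closed a :
  GRing.submod_closed [in [set x : fraction_module R |
    exists n r, (x : {fraction R}) * (a ^+ n)%:F = r%:F]].
Proof.
apply: in_submod_closed; first by exists 0%N, 0; rewrite mul0r tofrac0.
move=> s u v [n [r ur]] [m [t vt]].
exists (n + m)%N, (s * r * a ^+ m + t * a ^+ n).
rewrite /GRing.scale /= /fraction_scale exprD !(tofracM, tofracD) -ur -vt.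
by ring.
Qed.

(* R[1/a], as a submodule of Q *)
Definition fractions_over a : submodule (fraction_module R) :=
  Submodule (fractions_over_closed a).

Lemma not_embeds_fractions_over a b : principal_ideal_domain R ->
  a \isn't a GRing.unit -> a != 0 -> b != 0 ->
  (exists x y, x * a + y * b = 1) ->
  ~ embeds (submodule_type (fractions_over a))
           (submodule_type (fractions_over b)).
Proof.
move=> pidR nua a0 b0 ab [f finj]; move/negP: nua; apply.
have anF n : (a ^+ n)%:F != 0 by rewrite tofrac_eq0 expf_neq0.
have bnF n : (b ^+ n)%:F != 0 by rewrite tofrac_eq0 expf_neq0.
have uP n : ((a ^+ n)%:F^-1 : fraction_module R)
    \in submodule_pred (fractions_over a).
  by apply/mem_set; exists n, 1; rewrite mulVf ?tofrac1.
(* [u n] is the inverse of [a ^+ n], so [u 0] is the element 1. *)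
pose u n : submodule_type (fractions_over a) :=
  Sub ((a ^+ n)%:F^-1 : fraction_module R) (uP n).
have uE n : u 0%N = a ^+ n *: u n.
  apply: val_inj; rewrite /= /GRing.scale /= /fraction_scale.
  by rewrite mulfV // expr0 tofrac1 invr1.
have [k [c fc]] := set_mem (valP (f (u 0%N))).
have c0 : c != 0.
  rewrite -(tofrac_eq0 c) -fc mulf_neq0 //; apply/eqP => f0.
  have : u 0%N = 0 by apply: finj; rewrite linear0; apply: val_inj; rewrite f0.
  move/(congr1 \val)/eqP => /=.
  by rewrite invr_eq0 (negbTE (anF _)).
apply: (pid_dvdX_unit pidR c0) => n.
have [m [d fd]] := set_mem (valP (f (u n))).
apply: (comaximal_dvd (comaximalX ab n) (m := m)).
(* Since [f (u 0)] is [a ^+ n] times [f (u n)], clearing the denominators [b ^+ k] and [b ^+ m]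
   gives [c * b ^+ m = d * b ^+ k * a ^+ n]. *)
exists (d * b ^+ k); apply/eqP; rewrite -tofrac_eq !tofracM -fc -fd (uE n).
rewrite linearZ /= /GRing.scale /= /fraction_scale; apply/eqP; ring.
Qed.

End FractionModule.

Theorem proposition2p15 (R : idomainType) (hR : principal_ideal_domain R) :
  (local_ring R ->
     uniserial (fraction_module R) /\ weakly_uniserial (fraction_module R)) /\
  (~ local_ring R -> ~ weakly_uniserial (fraction_module R)).
Proof.
split=> [/local_ringP locR|nlocR wuni].
  suff uniR : uniserial (fraction_module R).
    by split=> //; apply: uniserial_weakly.
  apply: uniserial_fraction => a b.
  have [d [a' [b' [x [y [-> -> /locR[ua|ub]]]]]]] := pid_comaximal hR a b.
    by left; exists (b' / a'); rewrite mulrA mulrVK.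
  by right; exists (a' / b'); rewrite mulrA mulrVK.
apply/nlocR/local_ringP => a b x y xy1; apply: contrapT => /not_orP[/negP ua /negP ub].
(* If one of the two vanished, the relation [xy1] would make the other a unit. *)
have a0 : a != 0.
  apply: contraNneq ub => a0; apply/unitrPr; exists y.
  by rewrite -xy1 a0 mulr0 add0r mulrC.
have b0 : b != 0.
  apply: contraNneq ua => b0; apply/unitrPr; exists x.
  by rewrite -xy1 b0 mulr0 addr0 mulrC.
case: (wuni (fractions_over a) (fractions_over b)).
  by apply: not_embeds_fractions_over => //; exists x, y.
by apply: not_embeds_fractions_over => //; exists y, x; rewrite addrC.
Qed.
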